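(* For $n\ge 0$ let $P^{\mathrm{A}}_n(t)=\sum_{k=0}^{n}A(n,k)t^k$. For every $t\ge 0$, the sequence $\{P^{\mathrm{A}}_n(t)\}_{n=0}^{\infty}$ is the moment sequence of the probability measure $\mu^{\mathrm{A}}_t$ on $\mathbb{R}$, i.e. $\int_{\mathbb{R}} x^n\,d\mu^{\mathrm{A}}_t(x)=P^{\mathrm{A}}_n(t)$ for all $n\ge0$, where $\mu^{\mathrm{A}}_0=\delta_1$, \[\mu^{\mathrm{A}}_t=\sum_{j=1}^{\infty}(1-t)t^{j-1}\delta_{j(1-t)}\quad\text{if } 0<t<1,\] \[\mu^{\mathrm{A}}_1=e^{-x}\chi_{[0,+\infty)}(x)\,dx,\] \[\mu^{\mathrm{A}}_t=\sum_{j=0}^{\infty}\frac{t-1}{t^{j+1}}\delta_{j(t-1)}\quad\text{if } t>1.\] In particular $\{P^{\mathrm{A}}_n(t)\}_{n\ge0}$ is positive definite for $t\ge0$.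
   Context: For a finite real sequence $(a_1,\dots,a_s)$ the number of descends is $\#\{i\in\{1,\dots,s-1\}: a_i>a_{i+1}\}$. For $n\ge0$ and $0\le k\le n$, $A(n,k)$ is the number of permutations $\sigma$ of $\{1,\dots,n\}$ such that the sequence $(\sigma(1),\dots,\sigma(n))$ has exactly $k$ descends (so $A(0,0)=1$). $\delta_a$ denotes the Dirac measure at $a$, $\chi$ an indicator function. A real sequence $\{a_n\}_{n\ge0}$ is positive definite if $\sum_{i,j}a_{i+j}c_ic_j\ge0$ for every finitely supported real sequence $\{c_i\}$. *)

(* Defs.v *)
From HB Require Import structures.
From mathcomp Require Import all_boot all_order all_algebra perm.
From mathcomp Require Import all_classical all_reals all_analysis.

Set Implicit Arguments.
Unset Strict Implicit.
Unset Printing Implicit Defensive.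
Import Order.TTheory GRing.Theory Num.Theory.
Import numFieldNormedType.Exports.

Local Open Scope classical_set_scope.
Local Open Scope ring_scope.

(* [zip s (behead s)] lists the pairs (a_i, a_(i+1)), 1 <= i <= size s - 1. *)
Definition descends {d : Order.disp_t} {T : orderType d} (s : seq T) : nat :=
  count (fun p : T * T => (p.2 < p.1)%O) (zip s (behead s)).

(* A permutation of {1, ..., n} is read as one of {0, ..., n-1}; the successor
   shifts the values back, so the sequence below is (sigma(1), ..., sigma(n)). *)
Definition eulerian (n k : nat) : nat :=
  #|[set s : 'S_n | descends [seq (s i).+1 | i <- enum 'I_n] == k]%SET|.

Definition eulerian_poly (R : realType) (n : nat) : {poly R} :=
  \poly_(k < n.+1) (eulerian n k)%:R.

(* The set function A |-> mu_t(A); meaningful for t >= 0 only. *)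
Definition muA {R : realType} (t : R) (A : set (measurableTypeR R)) : \bar R :=
  if t == 0 then \d_(1 : measurableTypeR R) A
  else if t < 1 then
    (\sum_(1 <= j <oo) ((1 - t) * t ^+ j.-1)%:E *
      \d_((j%:R * (1 - t))%R : measurableTypeR R) A)%E
  else if t == 1 then
    (\int[lebesgue_measure]_(x in A) (expR (- x) * \1_(`[0, +oo[) x)%:E)%E
  else
    (\sum_(0 <= j <oo) ((t - 1) / t ^+ j.+1)%:E *
      \d_((j%:R * (t - 1))%R : measurableTypeR R) A)%E.

(* The library integral is total, so the existence of the moments is stated. *)
Definition moment_sequence {R : realType}
    (mu : {measure set (measurableTypeR R) -> \bar R}) (a : nat -> R) : Prop :=
  forall n : nat,
    mu.-integrable setT (fun x : measurableTypeR R => ((x : R) ^+ n)%:E) /\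
    (\int[mu]_x ((x : R) ^+ n)%:E = (a n)%:E)%E.

Definition positive_definite {R : realType} (a : nat -> R) : Prop :=
  forall c : nat -> R, finite_set [set i | c i != 0] ->
    0 <= \sum_(i \in [set: nat]) \sum_(j \in [set: nat]) a (i + j)%N * c i * c j.

(* Main.v *)
(* The insertion of a maximal letter gives the classical recurrence for the
   numbers of permutations with k descents, and by induction on n it gives
   Worpitzky's identity and its mirror image,
     sum_k A(n,k) C(x+k,n) = x^n,   sum_k A(n,k) C(x+n-k,n) = (x+1)^n.
   Summing them against a geometric weight with the negative binomial series
     sum_i C(i+n,n) s^i = (1-s)^-(n+1)
   evaluates the n-th moment of mu_t as P_n(t), for t > 1 and for 0 < t < 1
   respectively.  At t = 1 both sides are n!, and at t = 0 both are 1.  Positive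
   definiteness holds because sum_(i,j) a_(i+j) c_i c_j is the integral of
   (sum_i c_i x^i)^2. *)
Require Import Defs.
From HB Require Import structures.
From mathcomp Require Import all_boot all_order all_algebra perm.
From mathcomp Require Import all_classical all_reals all_analysis.
From mathcomp Require Import measurable_realfun.
From mathcomp Require Import zify ring lra.

Import Order.TTheory GRing.Theory Num.Theory.
Import numFieldNormedType.Exports.

Local Open Scope classical_set_scope.
Local Open Scope ring_scope.

(** * Permutations as words grown by insertion *)

Fixpoint insertions {T : Type} (x : T) (s : seq T) : seq (seq T) :=
  (x :: s) ::
    if s is y :: s' then [seq y :: w | w <- insertions x s'] else [::].

(** Growing words by their largest letter gives sums over permutations an induction on [n];
    [perm_words_enum] ties this list to ['S_n]. *)
Fixpoint perm_words (n : nat) : seq (seq nat) :=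
  if n is n'.+1 then flatten [seq insertions n w | w <- perm_words n']
  else [:: [::]].

Lemma size_insertions (T : Type) (x : T) (s : seq T) :
  size (insertions x s) = (size s).+1.
Proof. by elim: s => //= y s IHs; rewrite size_map IHs. Qed.

Lemma mem_insertions (T : eqType) (x : T) (s1 s2 : seq T) :
  s1 ++ x :: s2 \in insertions x (s1 ++ s2).
Proof.
elim: s1 => [|y s1 IHs] /=; first by case: s2 => [|y s2]; rewrite inE eqxx.
by rewrite inE map_f ?orbT.
Qed.

Lemma insertions_perm_eq (T : eqType) (x : T) (s w : seq T) :
  w \in insertions x s -> perm_eq w (x :: s).
Proof.
elim: s w => [|y s IHs] w /=; first by rewrite inE => /eqP->.
rewrite inE => /predU1P[-> //|/mapP[v /IHs vP ->]].
apply: (@perm_trans _ [:: y, x & s]); first by rewrite perm_cons.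
exact: permEl (perm_catCA [:: y] [:: x] s).
Qed.

Lemma perm_words_perm_eq (n : nat) (w : seq nat) :
  w \in perm_words n = perm_eq w (iota 1 n).
Proof.
elim: n w => [|n IHn] w.
  by rewrite inE; apply/eqP/idP => [-> //|/perm_nilP].
have iotaP : perm_eq (iota 1 n.+1) (n.+1 :: iota 1 n).
  by rewrite -{1}(addn1 n) iotaD add1n (permEl (perm_catC _ _)).
apply/flatten_mapP/idP => [[v]|wP].
  rewrite IHn => vP /insertions_perm_eq wP.
  by rewrite (permPl wP) perm_sym (permPl iotaP) perm_cons perm_sym.
have nw : n.+1 \in w by rewrite (perm_mem wP) (perm_mem iotaP) inE eqxx.
case/splitPr: nw wP => w1 w2 wP; exists (w1 ++ w2); last exact: mem_insertions.
rewrite IHn -(perm_cons n.+1) -(permPr iotaP) -(permPr wP).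
exact: permEl (perm_catCA [:: n.+1] w1 w2).
Qed.

Lemma size_perm_words (n : nat) : size (perm_words n) = n`!.
Proof.
elim: n => //= n IHn.
rewrite size_flatten /shape -map_comp sumnE big_map big_seq.
rewrite (eq_bigr (fun=> n.+1)) => [|w].
  by rewrite -big_seq big_const_seq count_predT iter_addn_0 IHn factS mulnC.
rewrite perm_words_perm_eq /= size_insertions => /perm_size ->.
by rewrite size_iota.
Qed.

Definition word {n : nat} (s : 'S_n) : seq nat :=
  [seq (s i).+1 | i <- enum 'I_n].

Lemma word_inj n : injective (@word n).
Proof.
move=> s1 s2 /eq_in_map eqs; apply/permP => i; apply/val_inj.
by have /(_ (mem_enum _ i)) [] := eqs i.
Qed.

Lemma word_perm_eq n (s : 'S_n) : perm_eq (word s) (iota 1 n).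
Proof.
have -> : iota 1 n = [seq i.+1 | i : 'I_n <- enum 'I_n].
  by rewrite (iotaDl 1 0) -val_enum_ord -map_comp.
rewrite /word (map_comp (fun i : 'I_n => i.+1) s) perm_map //.
apply: uniq_perm; rewrite ?(map_inj_uniq perm_inj) ?enum_uniq //.
move=> i; rewrite mem_enum; apply/mapP; exists (s^-1 i)%g; rewrite ?mem_enum //.
by rewrite permKV.
Qed.

(** By counting: the words of permutations are distinct, all occur in [perm_words n], and both lists
    have length n factorial, so [perm_words n] has no repetition and nothing else in it. *)
Lemma perm_words_enum n :
  perm_eq (perm_words n) [seq word s | s <- enum {: 'S_n}].
Proof.
set r := map _ _.
have ru : uniq r by rewrite map_inj_uniq ?enum_uniq //; exact: word_inj.
have sr : size r = n`! by rewrite size_map -cardE card_Sn.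
have rP : {subset r <= perm_words n}.
  by move=> _ /mapP[s _ ->]; rewrite perm_words_perm_eq word_perm_eq.
have szP : (size (perm_words n) <= size r)%N by rewrite size_perm_words sr.
rewrite perm_sym uniq_perm ?(leq_size_uniq ru rP) //.
exact: (uniq_min_size ru rP szP).2.
Qed.

(** * Descents under insertion and Worpitzky's identities *)

Lemma descends_size (d : Order.disp_t) (T : orderType d) (s : seq T) :
  (descends s <= (size s).-1)%N.
Proof.
rewrite /descends (leq_trans (count_size _ _)) //.
by rewrite size_zip size_behead geq_minr.
Qed.

Lemma descends_cons2 (d : Order.disp_t) (T : orderType d) (x y : T) s :
  descends [:: x, y & s] = ((y < x)%O + descends (y :: s))%N.
Proof. by []. Qed.

(* A maximal letter inserted at the end or inside a descent keeps the number of
   descents; inserted anywhere else, it creates a new one. *)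
Lemma sum_insertions_behead (d : Order.disp_t) (T : orderType d)
    (g : nat -> nat) (m x : T) (s : seq T) (k := descends (x :: s)) :
  (x < m)%O -> all (fun y => y < m)%O s ->
  (\sum_(w <- insertions m s) g (descends (x :: w)) =
  k.+1 * g k + (size s - k) * g k.+1)%N.
Proof.
rewrite {}/k; elim: s x g => [|y s IHs] x g xm => [_|/= /andP[ym sm]].
  by rewrite big_seq1 /descends /= ltNge ltW //= sub0n mul0n !addn0 mul1n.
 rewrite big_cons big_map.
under eq_bigr do rewrite descends_cons2.
(* The possible descent from [x] to [y] is absorbed into the test function, which is why [g] is
   arbitrary. *)
rewrite (IHs y (fun k => g ((y < x)%O + k)%N)) // !descends_cons2.
rewrite ym [(m < x)%O]ltNge (ltW xm) /=.
have := descends_size _ _ (y :: s); rewrite /= => dles.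
rewrite !(add0n, add1n); case: (y < x)%O => /=; rewrite !(add0n, add1n).
all: move: (descends (y :: s)) dles => k dles.
all: rewrite ?subSS ?subSn // !mulSn; lia.
Qed.

(** The position left out by [sum_insertions_behead] is the front; there the maximal letter creates
    a descent as soon as the word is nonempty. *)
Lemma sum_insertions (d : Order.disp_t) (T : orderType d) (g : nat -> nat)
    (m : T) (s : seq T) (k := descends s) :
  all (fun y => y < m)%O s ->
  (\sum_(w <- insertions m s) g (descends w) =
  k.+1 * g k + (size s - k) * g k.+1)%N.
Proof.
rewrite {}/k; case: s => [_|x s /= /andP[xm sm]].
  by rewrite big_seq1 sub0n mul0n addn0 mul1n.
rewrite big_cons big_map sum_insertions_behead //.
rewrite descends_cons2 xm add1n subSn ?mulSn; last first.
  exact: descends_size (x :: s).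
lia.
Qed.

Lemma perm_words_descends n w : w \in perm_words n -> (descends w <= n)%N.
Proof.
rewrite perm_words_perm_eq => /perm_size; rewrite size_iota => <-.
exact: leq_trans (descends_size _ _ w) (leq_pred _).
Qed.

(** This is the recurrence A(n+1,k) = (k+1) A(n,k) + (n+1-k) A(n,k-1) tested against an arbitrary
    [g]; both Worpitzky identities are instances of [g]. *)
Lemma sum_perm_wordsS (g : nat -> nat) n :
  (\sum_(w <- perm_words n.+1) g (descends w) =
   \sum_(w <- perm_words n)
     ((descends w).+1 * g (descends w) +
      (n - descends w) * g (descends w).+1))%N.
Proof.
rewrite big_flatten big_map big_seq [RHS]big_seq; apply: eq_bigr => w.
rewrite perm_words_perm_eq => wP; rewrite sum_insertions.
  by rewrite (perm_size wP) size_iota.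
by apply/allP => i; rewrite (perm_mem wP) mem_iota ltEnat add1n => /andP[].
Qed.

Lemma worpitzky n x :
  (\sum_(w <- perm_words n) 'C(x + descends w, n) = x ^ n)%N.
Proof.
elim: n => [|n IHn]; first by rewrite big_seq1 bin0.
rewrite (sum_perm_wordsS (fun k => 'C(x + k, n.+1))) expnS -IHn big_distrr /=.
rewrite big_seq [RHS]big_seq; apply: eq_bigr => w /perm_words_descends.
move: (descends w) => k kn; rewrite addnS binS.
(* The identity holds word by word: after Pascal's rule, (n+1) C(x+k,n+1) = (x+k-n) C(x+k,n) leaves
   (x+k-n) + (n-k) = x as coefficient of C(x+k,n). The subtraction is truncated, but for x+k < n all
   binomials vanish. *)
have := mul_bin_left (x + k) n; have [nxk|nxk] := leqP n (x + k); first nia.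
rewrite !bin_small //; lia.
Qed.

Lemma worpitzky_rev n i :
  (\sum_(w <- perm_words n) 'C(i + (n - descends w), n) = i.+1 ^ n)%N.
Proof.
elim: n => [|n IHn]; first by rewrite big_seq1 bin0.
rewrite (sum_perm_wordsS (fun k => 'C(i + (n.+1 - k), n.+1))).
rewrite expnS -IHn big_distrr /=.
rewrite big_seq [RHS]big_seq; apply: eq_bigr => w /perm_words_descends.
move: (descends w) => k kn; rewrite subSS subSn // addnS binS.
(* Here the coefficient of C(i+n-k,n) is (i-k) + (k+1) = i+1; for i < k all binomials vanish. *)
have := mul_bin_left (i + (n - k)) n.
have [ki|ik] := leqP k i; first nia.
rewrite !bin_small //; lia.
Qed.

(** * The Eulerian polynomial as a sum over words, and its special values *)

Lemma eulerian_polyE (R : realType) n (t : R) :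
  (eulerian_poly R n).[t] = \sum_(w <- perm_words n) t ^+ descends w.
Proof.
rewrite (perm_big _ (perm_words_enum n)) big_map /= horner_poly.
rewrite big_enum /=.
rewrite (partition_big (fun s => inord (descends (word s)) : 'I_n.+1) xpredT) //=.
apply: eq_bigr => k _.
rewrite /eulerian mulr_natl -sumr_const; apply: eq_big => s; rewrite !inE /=.
  rewrite -val_eqE /= inordK // ltnS perm_words_descends //.
  by rewrite perm_words_perm_eq word_perm_eq.
by move=> /eqP->.
Qed.

Lemma eulerian_poly0 (R : realType) (t : R) : (eulerian_poly R 0).[t] = 1.
Proof. by rewrite eulerian_polyE big_seq1 expr0. Qed.

Lemma eulerian_poly_at1 (R : realType) n : (eulerian_poly R n).[1] = n`!%:R.
Proof.
rewrite eulerian_polyE; under eq_bigr do rewrite expr1n.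
by rewrite big_const_seq count_predT size_perm_words iter_addr addr0.
Qed.

Lemma eulerian_poly_at0 (R : realType) n : (eulerian_poly R n).[0] = 1.
Proof.
(* C(n-k,n) and 0^k are both 1 for k = 0 and 0 otherwise, so the mirror identity at i = 0 gives the
   value. *)
transitivity ((\sum_(w <- perm_words n) 'C(0 + (n - descends w), n))%N%:R : R).
  rewrite eulerian_polyE natr_sum big_seq [RHS]big_seq; apply: eq_bigr => w.
  move=> /perm_words_descends; case: (descends w) => [|k] kn.
    by rewrite subn0 binn expr0.
  by rewrite bin_small ?expr0n //; lia.
by rewrite worpitzky_rev exp1n.
Qed.

(** * Negative binomial series and the power series of the Eulerian polynomials *)

Lemma cvg_binomial_series (R : realType) (s : R) m : 0 <= s < 1 ->
  series (fun i => 'C(i + m, m)%:R * s ^+ i) @ \oo --> (1 - s) ^- m.+1.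
Proof.
case/andP=> s0 s1; have s1' : 0 < 1 - s by rewrite subr_gt0.
elim: m => [|m IHm].
  rewrite (_ : (fun i => _) = geometric 1 s); last first.
    by apply/funext => i; rewrite bin0 /= !mul1r.
  by rewrite expr1 -[_^-1]mul1r; apply: cvg_geometric_series; rewrite ger0_norm.
set u := fun i => _ in IHm; set v := fun i => _.
have u0 i : 0 <= u i by rewrite mulr_ge0 ?exprn_ge0.
have v0 i : 0 <= v i by rewrite mulr_ge0 ?exprn_ge0.
have incr (f : nat -> R) : (forall i, 0 <= f i) -> nondecreasing_seq (series f).
  by move=> f0; apply: nondecreasing_series => i _ _.
(* Pascal's rule at the level of partial sums; in the limit it becomes l = (1-s)^-(m+1) + s l, which
   determines l once convergence is known. *)
have recv N : series v N.+1 = series u N.+1 + s * series v N.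
  rewrite /series /= [LHS]big_nat_recl // [in RHS]big_nat_recl //.
  rewrite mulr_sumr -addrA -big_split /=; congr (_ + _); first by rewrite /u /v !binn.
  apply: eq_bigr => i _; rewrite /u /v addSn binS natrD exprS addnS addSn; ring.
have leu N : series u N <= (1 - s) ^- m.+1.
  rewrite -(cvg_lim _ IHm) //; apply: nondecreasing_cvgn_le; first exact: incr.
  by apply/cvg_ex; eexists; exact: IHm.
(* Monotonicity in [recv] gives (1-s) V_N <= U_(N+1), where U and V are the partial sums of [u] and
   [v]; so V is bounded and converges. *)
have bndv N : series v N <= (1 - s) ^- m.+2.
  rewrite exprSr invfM -ler_pdivrMr ?invr_gt0 // invrK mulrBr mulr1.
  rewrite lerBlDr (le_trans (incr v v0 _ _ (leqnSn N))) // recv mulrC.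
  by rewrite [_ * s]mulrC lerD2r.
have : cvgn (series v).
  apply: nondecreasing_is_cvgn; first exact: incr.
  by exists ((1 - s) ^- m.+2) => _ [N _ <-].
case/cvg_ex => l /= vl; suff <- : l = (1 - s) ^- m.+2 by [].
have : series v N.+1 @[N --> \oo] --> (1 - s) ^- m.+1 + s * l.
  under eq_fun do rewrite recv.
  apply: cvgD; first by rewrite (cvg_shiftS (series u)).
  exact: cvgMl_tmp.
rewrite (cvg_shiftS (series v)) => vl'.
have e : l = (1 - s) ^- m.+1 + s * l by apply: cvg_unique vl vl'.
apply: (mulIf (lt0r_neq0 s1')).
rewrite exprSr invfM mulfVK ?lt0r_neq0 //; lra.
Qed.

(** The first [k] terms vanish since i + (n-k) < n; shifting the index by [k] releases the factor
    s^k. *)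
Lemma binomial_eseries (R : realType) (s : R) n k : 0 <= s < 1 -> (k <= n)%N ->
  (\sum_(i <oo) ('C(i + (n - k), n)%:R * s ^+ i)%:E =
   (s ^+ k * (1 - s) ^- n.+1)%:E)%E.
Proof.
move=> s01 kn; have /andP[s0 _] := s01.
rewrite (nneseries_split _ k) /=; last first.
  by move=> *; rewrite lee_fin mulr_ge0 ?exprn_ge0.
rewrite big1_seq ?add0e => [|i]; last first.
  by rewrite mem_index_iota add0n => ik; rewrite bin_small ?mul0r //; lia.
rewrite add0n -nneseries_addn => [|i]; last first.
  by rewrite lee_fin mulr_ge0 ?exprn_ge0.
under eq_eseriesr => i _.
  rewrite -addnA subnKC // exprD mulrA [_ * s ^+ k]mulrC EFinM.
  over.
rewrite /= nneseriesZl => [|i _]; last by rewrite lee_fin mulr_ge0 ?exprn_ge0.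
rewrite [in RHS]EFinM; congr (_ * _)%E; apply/cvg_lim => //.
under eq_fun do rewrite sumEFin.
by apply/cvg_EFin; [exact: nearW|exact: cvg_binomial_series].
Qed.

Lemma eulerian_eseriesS (R : realType) (t : R) n : 0 <= t < 1 ->
  (\sum_(j <oo) (t ^+ j * j.+1%:R ^+ n)%:E =
   ((eulerian_poly R n).[t] * (1 - t) ^- n.+1)%:E)%E.
Proof.
move=> t01; have /andP[t0 _] := t01.
under eq_eseriesr => j _.
  rewrite -natrX -worpitzky_rev natr_sum mulrC mulr_suml -sumEFin; over.
rewrite nneseries_sum => [|w j _]; last by rewrite lee_fin mulr_ge0 ?exprn_ge0.
rewrite eulerian_polyE mulr_suml -sumEFin big_seq [RHS]big_seq.
by apply: eq_bigr => w /perm_words_descends; exact: binomial_eseries.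
Qed.

Lemma eulerian_eseries (R : realType) (t : R) n : 1 < t ->
  (\sum_(j <oo) (t ^- j.+1 * j%:R ^+ n)%:E =
   ((eulerian_poly R n).[t] * (t - 1) ^- n.+1)%:E)%E.
Proof.
move=> t1; have t0 : 0 < t by exact: lt_trans t1.
have s01 : 0 <= t^-1 < 1 by rewrite invr_ge0 ltW //= invf_lt1.
have tN0 : t != 0 by rewrite gt_eqF.
have tN1 : t - 1 != 0 by rewrite subr_eq0 gt_eqF.
under eq_eseriesr => j _.
  rewrite -natrX -worpitzky natr_sum mulr_sumr -sumEFin; over.
rewrite nneseries_sum => [|w j _]; last first.
  by rewrite lee_fin mulr_ge0 // invr_ge0 exprn_ge0 // ltW.
rewrite eulerian_polyE mulr_suml -sumEFin big_seq [RHS]big_seq.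
apply: eq_bigr => w /perm_words_descends; move: (descends w) => d dn.
(* Writing d as n - (n-d) makes [binomial_eseries] applicable with k = n-d and s = 1/t. *)
under eq_eseriesr => j _.
  rewrite (_ : _ * _ =
    t^-1 * ('C(j + (n - (n - d)), n)%:R * t^-1 ^+ j)); last first.
    by rewrite subKn // exprS invfM exprVn; ring.
  rewrite EFinM; over.
rewrite /= nneseriesZl => [|i _]; last first.
  by rewrite lee_fin mulr_ge0 ?exprn_ge0 // invr_ge0 ltW.
rewrite binomial_eseries ?leq_subr // -EFinM; congr _%:E.
(* The factor t^(n+1) released here, against t^-(n-d+1), leaves t^d. *)
have -> : 1 - t^-1 = (t - 1) / t by field.
rewrite expr_div_n invfM invrK (mulrC (_ ^- _)) !mulrA -exprS exprVn.
rewrite (_ : n.+1 = ((n - d).+1 + d)%N); last by lia.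
by rewrite [X in _ * X * _]exprD mulKf // expf_neq0.
Qed.

(** * Moments of measures on the half-line, and the discrete cases *)

(** Almost everywhere x^n = |x|^n, so the absolute moments yield integrability and value at once,
    and only integrals of nonnegative functions remain to be computed. *)
Lemma moment_sequence_nneg (R : realType)
    (mu : {measure set (measurableTypeR R) -> \bar R}) (a : nat -> R) :
  mu `]-oo, 0[%classic = 0 ->
  (forall n, \int[mu]_x (`|x : R| ^+ n)%:E = (a n)%:E)%E ->
  moment_sequence mu a.
Proof.
move=> mu0 mua n.
have mX : measurable_fun [set: measurableTypeR R]
    (EFin \o (fun x : R => x ^+ n)).
  exact/measurable_EFinP/measurable_funX.
have mN : measurable_fun [set: measurableTypeR R]
    (EFin \o (fun x : R => `|x| ^+ n)).
  apply/measurable_EFinP; apply: measurable_funX; exact: normr_measurable.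
split.
  apply/integrableP; split => //.
  by under eq_integral do rewrite abse_EFin normrX; rewrite mua ltry.
rewrite -mua; apply: ae_eq_integral => //.
exists `]-oo, 0[%classic; split => // x /= /not_implyP[_ xn].
rewrite in_itv /= ltNge; apply: contra_notN xn => x0.
by rewrite ger0_norm.
Qed.

(** Assembled from [mseries] and [mscale] so that the measure structure is inferred; [mscale]
    dictates the type of the weights. *)
Definition weighted_diracs {R : realType} (w : nat -> {nonneg R})
    (x : nat -> R) :
    {measure set (measurableTypeR R) -> \bar R} :=
  mseries (fun j => mscale (w j) \d_(x j : measurableTypeR R)) 0.

Lemma ge0_integral_weighted_diracs (R : realType) (w : nat -> {nonneg R})
    (x : nat -> R) (f : R -> R) :
  measurable_fun setT f -> (forall y, 0 <= f y) ->
  (\int[weighted_diracs w x]_y (f y)%:E =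
   \sum_(j <oo) ((w j)%:num * f (x j))%:E)%E.
Proof.
move=> mf f0; have mEf : measurable_fun [set: measurableTypeR R] (EFin \o f).
  exact/measurable_EFinP.
rewrite /weighted_diracs ge0_integral_measure_series //; last first.
  by move=> *; rewrite lee_fin.
apply: eq_eseriesr => j _; rewrite ge0_integral_mscale //; last first.
  by move=> *; rewrite lee_fin.
by rewrite integral_dirac // diracT mul1e.
Qed.

Lemma moment_sequence_weighted_diracs (R : realType) (w : nat -> {nonneg R})
    (x a : nat -> R) :
  (forall j, 0 <= x j) ->
  (forall n, \sum_(j <oo) ((w j)%:num * x j ^+ n)%:E = (a n)%:E)%E ->
  moment_sequence (weighted_diracs w x) a.
Proof.
move=> x0 wxa; apply: moment_sequence_nneg => [|n].
  apply: eseries0 => j _ _.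
  transitivity ((w j)%:num%:E *
    \d_(x j : measurableTypeR R) `]-oo, 0%R[%classic)%E => //.
  rewrite diracE memNset ?mule0 //=.
  by rewrite in_itv /= ltNge x0.
rewrite (ge0_integral_weighted_diracs _ w x (fun y => `|y| ^+ n)) //.
- by under eq_eseriesr do rewrite ger0_norm //.
- apply: measurable_funX; exact: normr_measurable.
Qed.

Lemma moment_sequence_dirac1 (R : realType) :
  moment_sequence (\d_(1 : measurableTypeR R)) (fun=> 1 : R).
Proof.
apply: moment_sequence_nneg => [|n].
  by rewrite /= diracE memNset //= in_itv /= ltNge ler01.
rewrite integral_dirac //= ?diracT ?mul1e ?normr1 ?expr1n //.
apply/measurable_EFinP; apply: measurable_funX; exact: normr_measurable.
Qed.

Lemma muA_lt1 (R : realType) (t : R) : 0 < t < 1 ->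
  exists mu : {measure set (measurableTypeR R) -> \bar R},
    (forall A, mu A = muA t A) /\
    moment_sequence mu (fun n => (eulerian_poly R n).[t]).
Proof.
case/andP=> t0 t1; have t1' : 0 < 1 - t by rewrite subr_gt0.
have w0 j : 0 <= (1 - t) * t ^+ j by rewrite mulr_ge0 ?exprn_ge0 // ltW.
(* The series in [muA] starts at j = 1; the index is shifted to start at 0. *)
exists (weighted_diracs (fun j => NngNum (w0 j))
  (fun j => j.+1%:R * (1 - t))); split.
  move=> A; rewrite /muA gt_eqF // t1 -nneseries_addn => [|j]; last first.
    by rewrite mule_ge0 // lee_fin.
  by apply: eq_eseriesr => j _; rewrite addn1.
apply: moment_sequence_weighted_diracs => [j|n]; first by rewrite mulr_ge0 ?ltW.
under eq_eseriesr => j _.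
  rewrite /= (_ : (1 - t) * t ^+ j * (j.+1%:R * (1 - t)) ^+ n =
    (1 - t) ^+ n.+1 * (t ^+ j * j.+1%:R ^+ n)); last first.
    by rewrite exprMn exprS; ring.
  rewrite EFinM; over.
rewrite /= nneseriesZl => [|j _]; last first.
  by rewrite lee_fin mulr_ge0 ?exprn_ge0 // ltW.
rewrite eulerian_eseriesS ?(ltW t0) // -EFinM mulrCA mulfV ?mulr1 //.
by rewrite expf_neq0 // gt_eqF.
Qed.

Lemma muA_gt1 (R : realType) (t : R) : 1 < t ->
  exists mu : {measure set (measurableTypeR R) -> \bar R},
    (forall A, mu A = muA t A) /\
    moment_sequence mu (fun n => (eulerian_poly R n).[t]).
Proof.
move=> t1; have t1' : 0 < t - 1 by rewrite subr_gt0.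
have t0 : 0 < t by exact: lt_trans t1.
have w0 j : 0 <= (t - 1) / t ^+ j.+1 by rewrite divr_ge0 ?exprn_ge0 // ltW.
exists (weighted_diracs (fun j => NngNum (w0 j))
  (fun j => j%:R * (t - 1))); split.
  by move=> A; rewrite /muA gt_eqF // ltNge (ltW t1) /= gt_eqF.
apply: moment_sequence_weighted_diracs => [j|n].
  by rewrite mulr_ge0 // ltW.
under eq_eseriesr => j _.
  rewrite /= (_ : (t - 1) / t ^+ j.+1 * (j%:R * (t - 1)) ^+ n =
    (t - 1) ^+ n.+1 * (t ^- j.+1 * j%:R ^+ n)); last first.
    by rewrite exprMn [(t - 1) ^+ n.+1]exprS; ring.
  rewrite EFinM; over.
rewrite /= nneseriesZl => [|j _]; last first.
  by rewrite lee_fin mulr_ge0 ?invr_ge0 ?exprn_ge0 // ltW.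
rewrite eulerian_eseries // -EFinM mulrCA mulfV ?mulr1 //.
by rewrite expf_neq0 // gt_eqF.
Qed.

(** * The exponential law, for t = 1 *)

(** The Radon-Nikodym derivative of [nu] has the same integral as [p] over every measurable set,
    hence equals [p] almost everywhere and may be replaced by it in the change of variables. *)
Lemma ge0_integral_density d (T : measurableType d) (R : realType)
    (nu : {finite_measure set T -> \bar R})
    (mu : {sigma_finite_measure set T -> \bar R}) (p f : T -> \bar R) :
  mu.-integrable setT p ->
  (forall A, measurable A -> nu A = \int[mu]_(x in A) p x)%E ->
  measurable_fun setT f -> (forall x, 0 <= f x)%E ->
  (\int[nu]_x f x = \int[mu]_x (f x * p x))%E.
Proof.
move=> ip nup mf f0; have mp := measurable_int _ ip.
have numu : nu `<< mu.
  apply/null_content_dominatesP => A mA muA0; rewrite nup //.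
  by apply: null_set_integral => //; exact: measurable_funTS.
rewrite -(Radon_Nikodym_SigmaFinite.change_of_variables numu) //.
have mg := measurable_int _ (Radon_Nikodym_SigmaFinite.f_integrable numu).
apply: ae_eq_integral => //; [exact: emeasurable_funM..|].
apply: ae_eqe_mul2l; apply: integral_ae_eq => //.
  exact: Radon_Nikodym_SigmaFinite.f_integrable.
by move=> E _ mE; rewrite -nup // -Radon_Nikodym_SigmaFinite.f_integral.
Qed.

Lemma cvgr_expRMexpr (R : realType) n :
  expR (- x) * x ^+ n @[x --> +oo] --> (0 : R).
Proof.
(* The upper bound comes from e^x >= 1 + x^(n+1)/(n+1)! for x > 0. *)
apply: (@squeeze_cvgr _ _ _ _ (cst 0) (fun x : R => n.+1`!%:R * x^-1)).
- near=> x; have x0 : 0 < x by near: x; apply: nbhs_pinfty_gt; exact: num_real.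
  rewrite mulr_ge0 ?expR_ge0 ?exprn_ge0 ?(ltW x0) //=.
  rewrite expRN mulrC ler_pdivrMr ?expR_gt0 // -ler_pdivrMl; last first.
    by rewrite divr_gt0 ?ltr0n ?fact_gt0.
  rewrite invfM invrK -mulrA -exprS mulrC.
  by apply: le_trans (expR_ge1Dxn n (ltW x0)); rewrite lerDr.
- exact: cvg_cst.
- rewrite -[X in _ --> X](mulr0 (n.+1`!%:R : R)); apply: cvgMl_tmp.
  apply/gtr0_cvgV0; last exact: cvg_id.
  by near=> x; near: x; apply: nbhs_pinfty_gt; exact: num_real.
Unshelve. all: end_near. Qed.

(** The polynomial Q_n = sum_(k <= n) (n!/k!) X^k of repeated integration by parts: -e^(-x) Q_n(x)
    is a primitive of x^n e^(-x), equal to -n! at 0 and tending to 0 at infinity. *)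
Fixpoint exp_primitive {R : realType} (n : nat) : {poly R} :=
  if n is n'.+1 then 'X^n + n%:R *: exp_primitive n' else 1.

Lemma deriv_exp_primitive (R : realType) n :
  (exp_primitive n : {poly R})^`() = exp_primitive n - 'X^n.
Proof.
elim: n => [|n IHn] /=; first by rewrite expr0 derivC subrr.
rewrite derivD derivZ IHn derivXn -scaler_nat scalerBr /=.
by rewrite [in RHS]addrAC subrr add0r addrC subrK.
Qed.

Lemma exp_primitive_at0 (R : realType) n :
  (exp_primitive n : {poly R}).[0] = n`!%:R.
Proof.
elim: n => [|n IHn] /=; first by rewrite hornerC.
by rewrite hornerD hornerZ IHn hornerXn expr0n add0r factS natrM.
Qed.

Lemma cvg_expRM_exp_primitive (R : realType) n :
  expR (- x) * (exp_primitive n).[x] @[x --> +oo] --> (0 : R).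
Proof.
elim: n => [|n IHn] /=.
  under eq_fun => x do rewrite hornerC -(expr0 x).
  exact: cvgr_expRMexpr.
under eq_fun do rewrite hornerD hornerXn hornerZ mulrDr mulrCA.
have := cvgD (cvgr_expRMexpr R n.+1) (cvgMl_tmp (a := n.+1%:R) IHn).
by rewrite mulr0 addr0; exact.
Qed.

Lemma is_derive_exp_primitive (R : realType) n (x : R) :
  is_derive x 1 (fun y => - (expR (- y) * (exp_primitive n).[y]))
    (x ^+ n * expR (- x)).
Proof.
have dE : is_derive x 1 (fun y : R => expR (- y)) (- expR (- x)).
  by apply: (trigger_derive (is_derive1_comp _ _)); rewrite mulrN1.
have dP := is_derive_poly (exp_primitive n) x.
apply: trigger_derive.
rewrite deriv_exp_primitive hornerD hornerN hornerXn /GRing.scale /=; ring.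
Qed.

Lemma integral_exp_moment (R : realType) n :
  (\int[lebesgue_measure]_(x in `[0%R, +oo[) (x ^+ n * expR (- x))%:E
   = (n`!%:R : R)%:E)%E.
Proof.
pose F (y : R) := - (expR (- y) * (exp_primitive n).[y]).
have dF (x : R) : derivable F x 1 by case: (is_derive_exp_primitive R n x).
have cF : continuous F.
  by move=> x; apply/differentiable_continuous/derivable1_diffP.
rewrite (@ge0_continuous_FTC2y _ _ F _ 0) //.
- by rewrite /F exp_primitive_at0 oppr0 expR0 mul1r EFinN oppeK add0e.
- by move=> x x0; rewrite mulr_ge0 ?expR_ge0 ?exprn_ge0.
- apply: continuous_subspaceT => x; apply: cvgM; first exact: exprn_continuous.
  apply: continuous_comp; [exact: oppr_continuous|exact: continuous_expR].
- by rewrite -oppr0; apply: cvgN; exact: cvg_expRM_exp_primitive.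
- by apply: cvg_at_right_filter; exact: cF.
- move=> x _; rewrite derive1E.
  exact: (@derive_val _ _ _ _ _ _ _ (is_derive_exp_primitive R n x)).
Qed.

Lemma muA_1 (R : realType) (A : set (measurableTypeR R)) :
  muA 1 A = exponential_prob 1 A.
Proof.
rewrite /muA oner_eq0 ltxx eqxx /exponential_prob; apply: eq_integral => x _.
rewrite /exponential_pdf patchE indicE; case: ifP => _.
  by rewrite mulr1 mul1r mulN1r.
by rewrite mulr0.
Qed.

Lemma moment_sequence_exponential (R : realType)
    (nu : {finite_measure set (measurableTypeR R) -> \bar R}) :
  (forall A, nu A = exponential_prob 1 A) ->
  moment_sequence nu (fun n => n`!%:R).
Proof.
move=> nuE; apply: moment_sequence_nneg => [|n].
  rewrite /= nuE [LHS]integral0_eq // => x /=; rewrite in_itv /= => x0.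
  by rewrite lt0_exponential_pdf.
have mN : measurable_fun [set: measurableTypeR R]
    (EFin \o (fun x : R => `|x| ^+ n)).
  apply/measurable_EFinP; apply: measurable_funX; exact: normr_measurable.
rewrite (@ge0_integral_density _ _ R nu lebesgue_measure
  (EFin \o exponential_pdf 1)) //.
- rewrite -integral_exp_moment [RHS]integral_mkcond; apply: eq_integral => x _.
  rewrite /exponential_pdf /= !patchE; case: ifPn => [|_].
    rewrite inE /= in_itv /= andbT => x0.
    by rewrite -EFinM mul1r mulN1r ger0_norm.
  by rewrite mule0.
- exact: integrable_exponential_pdf.
Qed.

Lemma muA_eq1 (R : realType) :
  exists mu : {measure set (measurableTypeR R) -> \bar R},
    (forall A, mu A = muA 1 A) /\
    moment_sequence mu (fun n => (eulerian_poly R n).[1]).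
Proof.
have [nu nuE] : exists nu : probability (measurableTypeR R) R,
    forall A, nu A = exponential_prob 1 A.
  (* The probability structure rests on positivity of the rate, supplied by [ltr01]. *)
  by unshelve eexists (exponential_prob 1) => //; exact: ltr01.
exists nu; split=> [A|]; first by rewrite muA_1 -nuE.
under eq_fun do rewrite eulerian_poly_at1.
exact: moment_sequence_exponential.
Qed.

Lemma muA_eq0 (R : realType) :
  exists mu : {measure set (measurableTypeR R) -> \bar R},
    (forall A, mu A = muA 0 A) /\
    moment_sequence mu (fun n => (eulerian_poly R n).[0]).
Proof.
exists \d_(1 : measurableTypeR R); split=> [A|]; first by rewrite /muA eqxx.
under eq_fun do rewrite eulerian_poly_at0.
exact: moment_sequence_dirac1.
Qed.

(** * Positive definiteness and conclusion *)

Lemma moment_sequence_positive_definite (R : realType)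
    (mu : {measure set (measurableTypeR R) -> \bar R}) (a : nat -> R) :
  moment_sequence mu a -> positive_definite a.
Proof.
move=> mua c cfin.
pose r : seq nat := finmap.enum_fset (fset_set [set i | c i != 0]).
(* Both sums over all of [nat] are cut down to the finite support of [c], listed by [r]. *)
have supp (f : nat -> R) : (forall j, c j = 0 -> f j = 0) ->
    \sum_(j \in [set: nat]) f j = \sum_(j <- r) f j.
  move=> f0; rewrite -fsbig_finite //; apply/esym/fsbig_widen => // j [_ /=].
  by move=> /negP; rewrite negbK => /eqP /f0.
rewrite supp => [|i ci0]; last first.
  by rewrite fsbig1 // => j _; rewrite ci0 mulr0 mul0r.
rewrite (eq_bigr (fun i => \sum_(j <- r) a (i + j)%N * c i * c j))
  => [|i _]; last first.
  by apply: supp => j ->; rewrite mulr0.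
(* Indexing by pairs turns the double sum into one finite sum, exchanged with the integral in a
   single step. *)
pose q := [seq (i, j) | i <- r, j <- r].
pose f (p : nat * nat) (x : measurableTypeR R) : \bar R :=
  ((c p.1 * c p.2)%:E * ((x : R) ^+ (p.1 + p.2)%N)%:E)%E.
have fint p : mu.-integrable setT (f p).
  by apply: integrableZl => //; exact: (mua _).1.
rewrite -lee_fin; apply: (@le_trans _ _ (\int[mu]_x \sum_(p <- q) f p x)%E).
  apply: integral_ge0 => x _.
  rewrite (_ : (\sum_(p <- q) _)%E =
      ((\sum_(i <- r) c i * (x : R) ^+ i) ^+ 2)%:E).
    by rewrite lee_fin sqr_ge0.
  rewrite sumEFin big_allpairs /= expr2 mulr_suml; congr _%:E.
  apply: eq_bigr => i _; rewrite mulr_sumr; apply: eq_bigr => j _.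
  by rewrite exprD mulrACA.
rewrite integral_sum // big_allpairs -sumEFin le_eqVlt.
apply/orP; left; apply/eqP.
apply: eq_bigr => i _; rewrite -sumEFin; apply: eq_bigr => j _.
rewrite /f integralZl //; last exact: (mua _).1.
by rewrite (mua _).2 -EFinM mulrC mulrA.
Qed.

(** Needed because [mu] and its normalization are distinct bundled measures with the same underlying
    set function. *)
Lemma eq_moment_sequence (R : realType)
    (mu nu : {measure set (measurableTypeR R) -> \bar R}) (a : nat -> R) :
  mu =1 nu -> moment_sequence mu a -> moment_sequence nu a.
Proof. by move=> /funext/eq_measure ->. Qed.

Theorem theorem2p1 (R : realType) (t : R) (t_ge0 : 0 <= t) :
  (exists mu : probability (measurableTypeR R) R,
      (forall A : set (measurableTypeR R), mu A = muA t A) /\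
      moment_sequence mu (fun n : nat => (eulerian_poly R n).[t])) /\
  positive_definite (fun n : nat => (eulerian_poly R n).[t]).
Proof.
have [mu [muE mum]] : exists mu : {measure set (measurableTypeR R) -> \bar R},
    (forall A, mu A = muA t A) /\
    moment_sequence mu (fun n => (eulerian_poly R n).[t]).
  have [->|t0] := eqVneq t 0; first exact: muA_eq0.
  have [t1|t1|->] := ltgtP t 1; last exact: muA_eq1.
    by apply: muA_lt1; rewrite lt0r t0 t_ge0.
  exact: muA_gt1.
split; last exact: moment_sequence_positive_definite mum.
(* The total mass is the moment of order 0, which is P_0(t) = 1 in all four cases. *)
have mu1 : mu setT = 1%E.
  have [_] := mum 0; rewrite eulerian_poly0 => <-.
  by under eq_integral do rewrite expr0; rewrite integral_cst // mul1e.
(* [mnormalize] packages [mu], of total mass 1, as a probability. *)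
have nmuE : mnormalize mu \d_(1 : measurableTypeR R) = mu.
  by apply/funext => A; rewrite /mnormalize mu1 onee_eq0 /= invr1 mule1.
exists (mnormalize mu \d_(1 : measurableTypeR R)); split=> [A|].
  by rewrite -muE -nmuE.
by apply: eq_moment_sequence mum => A; rewrite -nmuE.
Qed.
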